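(* There is an absolute constant $C$ such that the following holds. Let $x\ge 2$ and let $T_1,\ldots,T_r$ be arbitrary disjoint nonempty subsets of the primes $\le x$. Let $k_1,\ldots,k_r\ge 0$ be integers and $P=\mathbb P_x(\omega(n;T_j)=k_j\ (1\le j\le r))$. Let $\eta=0$ if $T_1\cup\cdots\cup T_r$ contains every prime $\le x$ and $\eta=1$ otherwise; let $\xi=1$ if $\eta=k_1=\cdots=k_r=0$ and $\xi=0$ otherwise. Then \[ P\le C\prod_{j=1}^r\Big(\frac{H'(T_j)^{k_j}}{k_j!}\mathrm{e}^{-H(T_j)}\Big)\Big(\eta+\frac{k_1}{H'(T_1)}+\cdots+\frac{k_r}{H'(T_r)}\Big)+C\xi, \] and also \[ P\le C\prod_{j=1}^r\Big(\frac{(H(T_j)+2)^{k_j}}{k_j!}\mathrm{e}^{-H(T_j)}\Big). \]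
   Context: $\mathbb P_x$ denotes probability with respect to an integer $n$ drawn uniformly at random from $[1,x]$. For a finite set $T$ of primes, $\omega(n;T)=\#\{p\mid n:p\in T\}$, $H(T)=\sum_{p\in T}1/p$, $H'(T)=\sum_{p\in T}1/(p-1)$. *)

(* Defs.v *)
From HB Require Import structures.
From mathcomp Require Import all_boot all_order all_algebra.
From mathcomp Require Import reals Rstruct.
From mathcomp.analysis Require Import sequences exp.
Set Implicit Arguments. Unset Strict Implicit. Unset Printing Implicit Defensive.
Import Order.TTheory GRing.Theory Num.Theory.
Local Open Scope ring_scope.

(* A finite set of primes is represented as a duplicate-free list of naturals. *)

Definition omegaT (n : nat) (T : seq nat) : nat := count (fun p => p %| n)%N T.

Definition HT {R : realType} (T : seq nat) : R := \sum_(p <- T) (p%:R)^-1.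
Definition HT' {R : realType} (T : seq nat) : R := \sum_(p <- T) (p%:R - 1)^-1.

Definition Nx {R : realType} (x : R) : nat := Num.truncn x.

Definition probx {R : realType} (x : R) (E : pred nat) : R :=
  (count E (iota 1 (Nx x)))%:R / (Nx x)%:R.

(* Main.v *)
Require Import Defs.
From HB Require Import structures.
From mathcomp Require Import all_boot all_order all_algebra.
From mathcomp Require Import unstable reals Rstruct.
From mathcomp.analysis Require Import sequences exp.
From mathcomp Require Import zify ring lra.
Set Implicit Arguments. Unset Strict Implicit. Unset Printing Implicit Defensive.
Import Order.TTheory GRing.Theory Num.Theory.

(** Let [N] be the integer part of [x] and [E(k)] the set of [n <= N] with
[omega(n; T_j) = k_j] for all [j].  For [n > 1] in [E(k)], writing
[ln N = ln (N / n) + ln n] and [ln n = \sum ln p^a] over the prime powers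
[p^a] exactly dividing [n] gives [ln N <= \sum ln (N / m)] over the
factorisations [n = p^a m] with [p] not dividing [m].  Such an [m] lies in
[E(k)] if [p] is in no [T_j], which forces [eta = 1], and in [E(k - e_j)] if
[p] is in [T_j].  By Chebyshev's bound at most [O(y / ln y)] prime powers are
[<= y], so summing over [p^a] first bounds [ln N] times the number of [n] by
[O(N)] times the sum of [1 / m] over the relevant [m].  That sum is at most
[\prod_j H'(T_j)^(k_j) / k_j!], with one [k_j] lowered when [p] is in [T_j],
times the product of [1 / (1 - 1 / p)] over the [p <= N] outside all [T_j], and
Mertens' upper bound [\sum_(p <= N) 1 / p <= ln ln N + O(1)] turns the latter
product into [O(ln N) \prod_j exp (- H(T_j))].  The remaining integer [n = 1]
contributes [1 / N], which is [O(\prod_j exp (- H(T_j)))] again by Mertens. *)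

(** * Chebyshev and Mertens bounds *)

(** Powers of distinct primes are pairwise coprime. This turns prime-by-prime divisibility into
    lower bounds for binomials and factorials. *)
Lemma prod_prime_powers_dvdn (e : nat -> nat) m n d :
  (forall p, m <= p < n -> prime p -> p ^ e p %| d) ->
  \prod_(m <= p < n | prime p) p ^ e p %| d.
Proof.
move=> dvd_d; apply/Gauss_dvd_prod => [|p]; last first.
  by rewrite mem_index_iota; apply: dvd_d.
rewrite pairwise_map.
have : pairwise [rel x y | x != y] [seq i <- index_iota m n | prime i].
  by rewrite -uniq_pairwise filter_uniq // iota_uniq.
apply: (@sub_in_pairwise _ prime) => [p q /= pr_p pr_q neq_pq|]; last exact: filter_all.
by rewrite coprimeXl // coprimeXr // prime_coprime // dvdn_prime2.
Qed.

Lemma prime_dvd_fact p n : prime p -> (p %| n`!) = (p <= n).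
Proof.
move=> pr_p; elim: n => [|n IHn]; first by rewrite fact0 dvdn1 leqn0; case: p pr_p => [|[]].
rewrite factS Euclid_dvdM // IHn.
apply/orP/idP => [[/dvdn_leq->//|/leqW//]|].
by rewrite leq_eqVlt => /orP[/eqP->|]; [left | right].
Qed.

(** The two equal middle coefficients both occur in the expansion of
    [(1 + 1) ^ m.*2.+1 = 2 * 4 ^ m]. *)
Lemma leq_bin_odd m : 'C(m.*2.+1, m) <= 4 ^ m.
Proof.
rewrite -(leq_pmul2l (isT : 0 < 2)) mul2n -addnn.
have {2}-> : 'C(m.*2.+1, m) = 'C(m.*2.+1, m.+1).
  by rewrite -bin_sub; [congr 'C(_, _) |]; lia.
have -> : 2 * 4 ^ m = 2 ^ m.*2.+1 by rewrite expnS -mul2n expnM.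
rewrite (expnDn 1 1).
have lm : m < m.*2.+2 by lia.
have lm1 : m.+1 < m.*2.+2 by lia.
rewrite (bigD1 (Ordinal lm)) // (bigD1 (Ordinal lm1)) /=; last first.
  by rewrite -val_eqE /=; lia.
by rewrite !exp1n !muln1 addnA leq_addr.
Qed.

(** Erdős's induction: an even [n > 2] is not prime, so [n] drops by one; for [n = 2m + 1] the
    primes in [(m + 1, 2m + 1]] all divide ['C(2m + 1, m)], and the others form the primorial of
    [m + 1]. *)
Lemma primorial_leq n : \prod_(0 <= p < n.+1 | prime p) p <= 4 ^ n.
Proof.
elim/ltn_ind: n => n IHn.
have [n_le2|n_gt2] := leqP n 2.
  by case: n n_le2 {IHn} => [|[|[|]]] // _; rewrite unlock.
have [odd_n|even_n] := boolP (odd n); last first.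
  rewrite big_mkcond big_nat_recr //= -big_mkcond /= ifN ?muln1; last first.
    by apply: contra even_n => /even_prime[n2|//]; rewrite n2 in n_gt2.
  case: n n_gt2 {even_n} IHn => // n _ IHn.
  by apply: leq_trans (IHn _ _) _; rewrite ?leq_exp2l.
have [m Dn] : exists m, n = m.*2.+1 by exists n./2; lia.
rewrite (@big_cat_nat _ _ _ m.+2) //=; last by lia.
have -> : 4 ^ n = 4 ^ m.+1 * 4 ^ m by rewrite -expnD; congr (_ ^ _); lia.
apply: leq_mul; first by apply: IHn; lia.
apply: leq_trans (leq_bin_odd m); apply: dvdn_leq; first by rewrite bin_gt0; lia.
rewrite (eq_bigr (fun p => p ^ 1)) => [|p _]; last by rewrite expn1.
apply: (@prod_prime_powers_dvdn (fun=> 1)) => p /andP[mp pn] pr_p.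
rewrite expn1.
have : p %| (m.*2.+1)`! by rewrite prime_dvd_fact //; lia.
rewrite -(@bin_fact _ m); last by lia.
rewrite !Euclid_dvdM // !prime_dvd_fact // => /orP[//|]; lia.
Qed.

(** Only the first term [n %/ p] of Legendre's formula is kept. *)
Lemma prod_primes_divn_leq_fact n : \prod_(0 <= p < n.+1 | prime p) p ^ (n %/ p) <= n`!.
Proof.
apply: dvdn_leq (fact_gt0 n) _; apply: prod_prime_powers_dvdn => p /andP[_ pn] pr_p.
rewrite pfactor_dvdn ?fact_gt0 // logn_fact // big_ltn; last exact: leq_trans (prime_gt0 pr_p) _.
by rewrite expn1 leq_addr.
Qed.

Lemma fact_leq_expn n : n`! <= n ^ n.
Proof.
elim: n => // n IHn; rewrite factS expnS leq_mul2l /=.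
by apply: leq_trans IHn _; case: n => // n; rewrite leq_exp2r.
Qed.

Local Open Scope ring_scope.

Lemma ln_le (R : realType) (a b : R) : 0 < a -> a <= b -> ln a <= ln b.
Proof. by move=> a0 ab; rewrite ler_ln // posrE (lt_le_trans a0). Qed.

Lemma ln_natX (R : realType) (m n : nat) : (0 < m)%N -> ln ((m ^ n)%:R : R) = n%:R * ln m%:R.
Proof. by move=> m0; rewrite natrX lnXn ?ltr0n // mulr_natl. Qed.

Lemma ln_prod_nat (R : realType) (I : Type) (s : seq I) (P : pred I) (F : I -> nat) :
  (forall i, P i -> 0 < F i)%N ->
  ln ((\prod_(i <- s | P i) F i)%:R : R) = \sum_(i <- s | P i) ln (F i)%:R.
Proof.
move=> F_gt0.
suff [_ ->] : (0 < \prod_(i <- s | P i) F i)%N /\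
   ln ((\prod_(i <- s | P i) F i)%:R : R) = \sum_(i <- s | P i) ln (F i)%:R by [].
elim/big_rec2: _ => [|i y1 y2 Pi [y2_gt0 <-]]; first by rewrite ln1.
rewrite muln_gt0 F_gt0 // natrM lnM //; rewrite posrE ltr0n //; exact: F_gt0.
Qed.

Lemma chebyshev_theta (R : realType) n :
  \sum_(0 <= p < n.+1 | prime p) ln (p%:R : R) <= n%:R * ln 4.
Proof.
rewrite -ln_prod_nat; last exact: prime_gt0.
rewrite -ln_natX // ; apply: ln_le; last by rewrite ler_nat primorial_leq.
by rewrite ltr0n prodn_cond_gt0 //; exact: prime_gt0.
Qed.

(** Upper half of Mertens' first theorem, multiplied by [n]: with [n / p <= n %/ p + 1], the integer
    parts cost at most [ln n! <= n ln n], and the extra 1 for each prime costs Chebyshev's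
    [n ln 4]. *)
Lemma sum_ln_divr_prime_le (R : realType) n : (0 < n)%N ->
  \sum_(0 <= p < n.+1 | prime p) ln (p%:R : R) / p%:R <= ln n%:R + ln 4.
Proof.
move=> n_gt0; rewrite -(ler_pM2l (_ : 0 < n%:R)) ?ltr0n // mulrDr.
have : \sum_(0 <= p < n.+1 | prime p) (n %/ p)%:R * ln (p%:R : R) <= n%:R * ln n%:R.
  rewrite (eq_bigr (fun p => ln ((p ^ (n %/ p))%:R : R))) => [|p pr_p]; last first.
    by rewrite ln_natX // prime_gt0.
  rewrite -ln_prod_nat => [|p pr_p]; last by rewrite expn_gt0 prime_gt0.
  rewrite -ln_natX //; apply: ln_le.
    by rewrite ltr0n prodn_cond_gt0 // => p pr_p; rewrite expn_gt0 prime_gt0.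
  by rewrite ler_nat (leq_trans (prod_primes_divn_leq_fact n) (fact_leq_expn n)).
move/(lerD)/(_ (chebyshev_theta R n)); apply: le_trans.
rewrite -big_split mulr_sumr /=; apply: ler_sum => p pr_p.
have p_gt0 := prime_gt0 pr_p.
rewrite -[X in _ + X]mul1r -mulrDl mulrCA [X in X <= _]mulrC.
apply: ler_wpM2r; first by rewrite ln_ge0 // ler1n.
by rewrite ler_pdivrMr ?ltr0n // natr1 -natrM ler_nat ltnW // ltn_ceil.
Qed.

(* Abel summation against [1 / ln n], as an induction in which the nonnegative [D n]
   carries the boundary term. *)
Lemma sum_inv_prime_abel (R : realType) n
    (A := fun m => \sum_(0 <= p < m.+1 | prime p) ln (p%:R : R) / p%:R)
    (D := fun m => ln m%:R + ln 4 - A m) :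
  \sum_(0 <= p < n.+3 | prime p) (p%:R : R)^-1 + D n.+2 / ln n.+2%:R
    <= ln (ln n.+2%:R) + (3 - ln (ln 2)).
Proof.
have ln_gt0' m : 0 < ln (m.+2%:R : R) by rewrite ln_gt0 // ltr1n.
elim: n => [|n IHn].
  (* At 2 the prime sum is [1/2] and the boundary term is [5/2]; their total is the constant 3. *)
  rewrite {}/D {}/A !unlock /= !addr0.
  have l2 := ln_gt0' 0%N.
  have -> : ln (4 : R) = 2 * ln 2 by rewrite -[4]/((2 ^ 2)%:R) ln_natX.
  have -> : ln 2 + 2 * ln 2 - ln 2 / 2 = ln 2 * (5 / 2) :> R by field.
  by rewrite mulrAC divff ?gt_eqF // mul1r; lra.
have D_ge0 : 0 <= D n.+2 by rewrite subr_ge0 sum_ln_divr_prime_le.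
have l2 := ln_gt0' n; have l3 := ln_gt0' n.+1.
have l23 : ln n.+2%:R <= ln n.+3%:R :> R by apply: ln_le; rewrite ?ltr0n ?ler_nat.
have lnln : 1 - ln n.+2%:R / ln n.+3%:R <= ln (ln n.+3%:R) - ln (ln n.+2%:R) :> R.
  have q_gt0 : 0 < ln n.+2%:R / ln n.+3%:R :> R by rewrite divr_gt0.
  rewrite -opprB -[leRHS]opprB lerN2 -ln_div ?posrE //.
  by have := expR_ge1Dx (ln (ln n.+2%:R / ln n.+3%:R) : R); rewrite lnK ?posrE //; lra.
(* If [n.+3] is prime, its new reciprocal cancels against the drop in [D], so the same increment
   results in both cases. *)
have S_step : \sum_(0 <= p < n.+4 | prime p) (p%:R : R)^-1 + D n.+3 / ln n.+3%:R =
   \sum_(0 <= p < n.+3 | prime p) (p%:R : R)^-1 +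
     D n.+2 / ln n.+3%:R + (1 - ln n.+2%:R / ln n.+3%:R).
  have recr (F : nat -> R) : \sum_(0 <= p < n.+4 | prime p) F p =
      \sum_(0 <= p < n.+3 | prime p) F p + (if prime n.+3 then F n.+3 else 0).
    by rewrite big_mkcond big_nat_recr //= -big_mkcond.
  have q0 : n.+3%:R != 0 :> R by rewrite pnatr_eq0.
  rewrite /D /A !recr; move: (n.+3%:R : R) q0 l3 => q q0 l3.
  case: ifP => _; last by field; rewrite gt_eqF.
  by field; rewrite q0 gt_eqF.
rewrite S_step.
have : D n.+2 / ln n.+3%:R <= D n.+2 / ln n.+2%:R.
  by rewrite ler_wpM2l // lef_pV2 // posrE.
by move: IHn lnln; lra.
Qed.

Lemma mertens_upper (R : realType) : exists2 C : R, 0 < C &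
  forall n, (1 < n)%N -> expR (\sum_(0 <= p < n.+1 | prime p) (p%:R : R)^-1) <= C * ln n%:R.
Proof.
exists (expR (3 - ln (ln 2))); first exact: expR_gt0.
case=> [|[|n]] // _.
have ln_gt0' : 0 < ln (n.+2%:R : R) by rewrite ln_gt0 // ltr1n.
rewrite -{1}(lnK (x := ln n.+2%:R)) ?posrE // -expRD ler_expR addrC.
apply: le_trans (sum_inv_prime_abel R n); rewrite lerDl.
by rewrite divr_ge0 ?(ltW ln_gt0') // subr_ge0 sum_ln_divr_prime_le.
Qed.

(** The left sum counts the prime powers up to [n]. A prime with [p ^ 2 > n] counts at most once and
    has [ln (n + 1) <= 2 ln p], so Chebyshev applies; the at most [sqrt n] smaller primes have few
    powers each. The logarithm is at [n.+1] because [N / m] is later bounded by [(N %/ m).+1]. *)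
Lemma prime_powers_count_le (R : realType) : exists2 C : R, 0 < C & forall n,
  (\sum_(0 <= p < n.+1 | prime p) trunc_log p n)%:R * ln n.+1%:R <= C * n%:R.
Proof.
have l2 : 0 < ln 2 :> R by rewrite ln_gt0 // ltr1n.
have l4 : 0 < ln 4 :> R by rewrite ln_gt0 // ltr1n.
exists (2 * ln 4 + 32 / ln 2); first by rewrite addr_gt0 ?divr_gt0 ?mulr_gt0.
move=> n; have [->|n_gt0] := posnP n; first by rewrite unlock /= ln1 !mulr0.
have ln_n1 : 0 <= ln n.+1%:R :> R by rewrite ln_ge0 // ler1n.
rewrite natr_sum mulr_suml (bigID (fun p => p ^ 2 <= n)%N) /= addrC mulrDl.
apply: lerD.
  apply: (@le_trans _ _ (2 * \sum_(0 <= p < n.+1 | prime p) ln (p%:R : R))); last first.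
    by rewrite -mulrA ler_pM2l // [X in _ <= X]mulrC chebyshev_theta.
  rewrite mulr_sumr big_mkcondr /=; apply: ler_sum => p pr_p.
  have p1 := prime_gt1 pr_p.
  rewrite -ltnNge; case: ifP => [n_lt|_]; last by rewrite mulr_ge0 // ln_ge0 // ler1n ltnW.
  have -> : 2 * ln p%:R = ln (p ^ 2)%:R :> R by rewrite ln_natX // ltnW.
  apply: (@le_trans _ _ (1 * ln n.+1%:R)); last first.
    by rewrite mul1r; apply: ln_le; rewrite ?ltr0n // ler_nat.
  apply: ler_wpM2r => //; rewrite lern1 -ltnS -(ltn_exp2l _ _ p1).
  exact: leq_ltn_trans (trunc_logP p1 n_gt0) _.
(* [w] is the fourth root of [n + 1]. There are at most [w ^+ 2] small primes, and both logarithms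
   are [O(w)] by [1 + y <= exp y], so their total is [O(w ^+ 4)]. *)
pose w := expR (ln n.+1%:R / 4 : R).
have w_gt0 : 0 < w := expR_gt0 _.
have w4 : w ^+ 4 = n.+1%:R.
  by rewrite -expRM_natl mulrCA divff ?mulr1 ?lnK ?posrE ?ltr0n // pnatr_eq0.
have ln_w : ln n.+1%:R <= 4 * w.
  by have := expR_ge1Dx (ln n.+1%:R / 4 : R); rewrite -/w; lra.
have log_w : (trunc_log 2 n)%:R <= 4 * w / ln 2.
  rewrite ler_pdivlMr // -ln_natX //; apply: le_trans ln_w.
  apply: ln_le; first by rewrite ltr0n expn_gt0.
  by rewrite ler_nat leqW // trunc_logP.
pose t := Num.truncn (w ^+ 2).
have t_le : t%:R <= w ^+ 2 by rewrite truncn_le exprn_ge0 // ltW.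
have F_le p : prime p && (p ^ 2 <= n)%N ->
    (trunc_log p n)%:R * ln n.+1%:R <= 4 * w / ln 2 * (4 * w).
  move=> /andP[pr_p _]; apply: ler_pM => //; apply: le_trans log_w; rewrite ler_nat.
  have p1 := prime_gt1 pr_p.
  apply: trunc_log_max => //; apply: leq_trans (trunc_logP p1 n_gt0).
  by case: (trunc_log p n) => [|l]; rewrite ?expn0 // leq_exp2r.
apply: le_trans (ler_sum _ F_le) _.
rewrite big_const_seq iter_addr_0 -[X in X <= _]mulr_natl.
apply: (@le_trans _ _ (w ^+ 2 * (4 * w / ln 2 * (4 * w)))).
  apply: ler_wpM2r; first by rewrite !mulr_ge0 ?invr_ge0 // ltW.
  apply: le_trans t_le; rewrite ler_nat -size_filter -(size_iota 1 t).
  apply: uniq_leq_size => [|p]; first by rewrite filter_uniq // iota_uniq.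
  rewrite mem_filter mem_iota => /andP[/andP[pr_p p2] _]; rewrite prime_gt0 //= add1n ltnS.
  rewrite /t truncn_ge_nat ?exprn_ge0 ?(ltW w_gt0) //.
  rewrite -ler_sqr ?nnegrE ?ler0n ?exprn_ge0 ?(ltW w_gt0) //.
  by rewrite -exprM w4 -natrX ler_nat leqW.
have -> : w ^+ 2 * (4 * w / ln 2 * (4 * w)) = 16 / ln 2 * w ^+ 4 by field; rewrite gt_eqF.
have -> : 32 / ln 2 * n%:R = 16 / ln 2 * (2 * n%:R) :> R by field; rewrite gt_eqF.
by rewrite w4 ler_pM2l ?divr_gt0 // -natrM ler_nat; lia.
Qed.

(** * Integers with prescribed numbers of prime factors *)

Lemma sum_mem_index_iota (R : nmodType) (T : seq nat) m n (F : nat -> R) :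
  uniq T -> (forall q, q \in T -> (m <= q < n)%N) ->
  \sum_(p <- T) F p = \sum_(m <= p < n | p \in T) F p.
Proof.
move=> uT bdT; rewrite -[RHS]big_filter; apply: perm_big; apply: uniq_perm => //.
  by rewrite filter_uniq // iota_uniq.
by move=> q; rewrite mem_filter mem_index_iota; apply/esym/andb_idr => /bdT.
Qed.

Lemma ler_sum_inj (R : numDomainType) (I J : finType) (g : I -> J)
    (P : pred I) (Q : pred J) (F : I -> R) (G : J -> R) :
  {in P &, injective g} -> (forall i, P i -> Q (g i)) ->
  (forall i, P i -> F i <= G (g i)) -> (forall j, Q j -> 0 <= G j) ->
  \sum_(i | P i) F i <= \sum_(j | Q j) G j.
Proof.
move=> g_inj PQ FG G_ge0; apply: le_trans (ler_sum _ FG) _.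
rewrite -(big_imset (h := g) (A := P) G) //= [X in _ <= X](bigID (mem (g @: P))) /=.
rewrite (eq_bigl (fun j => Q j && (j \in g @: P))) => [|j]; last first.
  by apply/idP/andP => [/imsetP[i Pi ->]|[//]]; split; [exact: PQ | rewrite imset_f].
by rewrite lerDl sumr_ge0 // => j /andP[/G_ge0].
Qed.

Definition in_class r (T : 'I_r -> seq nat) (k : 'I_r -> nat) : pred nat :=
  fun n => [forall j, omegaT n (T j) == k j].

(** The vector [k - e_j]. Subtraction truncates, so at [k j = 0] this is [k] itself; the sums below
    carry the guard [0 < k j]. *)
Definition decr r (k : 'I_r -> nat) (j : 'I_r) : 'I_r -> nat :=
  fun i => (k i - (i == j))%N.

Lemma omegaT_pfactor_mul p a m T : prime p -> ~~ (p %| m)%N -> (0 < a)%N -> uniq T ->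
  (forall q, q \in T -> prime q) -> omegaT (p ^ a * m)%N T = (omegaT m T + (p \in T))%N.
Proof.
move=> pr_p pm a0; rewrite /omegaT; elim: T => //= q T IHT /andP[qT uT] prT.
have pr_q : prime q by rewrite prT ?mem_head.
rewrite IHT // => [|q' q'T]; last by rewrite prT // in_cons q'T orbT.
rewrite in_cons Euclid_dvdM // Euclid_dvdX // a0 andbT dvdn_prime2 // [p == q]eq_sym.
by have [eqp|_] /= := eqVneq q p; rewrite -?eqp; [rewrite (negbTE qT) eqp (negbTE pm) | ]; lia.
Qed.

Lemma omegaT1 T : (forall q, q \in T -> prime q) -> omegaT 1 T = 0%N.
Proof.
move=> prT; apply/eqP; rewrite -leqn0 leqNgt -has_count; apply/hasPn => q /prT pr_q.
by rewrite dvdn1; apply: contraTN pr_q => /eqP->.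
Qed.

(** By disjointness [p] lies in at most one [T j], so removing [p ^ a] lowers at most one of the
    counts, and by exactly one. *)
Lemma in_class_split r (T : 'I_r -> seq nat) k p a m :
  (forall j, uniq (T j)) -> (forall j q, q \in T j -> prime q) ->
  (forall i j q, i != j -> q \in T i -> q \notin T j) ->
  prime p -> ~~ (p %| m)%N -> (0 < a)%N -> in_class T k (p ^ a * m)%N ->
  (forall j, p \in T j -> (0 < k j)%N && in_class T (decr k j) m) /\
  ([forall j, p \notin T j] -> in_class T k m).
Proof.
move=> uT prT disj pr_p pm a0 /forallP /= inE.
have {}inE i : (omegaT m (T i) + (p \in T i))%N = k i.
  by rewrite -(@omegaT_pfactor_mul p a) // ?(eqP (inE i)) //; apply: prT.
split=> [j pj|/forallP pT]; last first.
  by apply/forallP => j; rewrite -inE (negbTE (pT j)) addn0.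
rewrite -{1}inE pj addn1 /=; apply/forallP => i; rewrite /decr -inE.
have [->|neq_ij] := eqVneq i j; first by rewrite pj addnK.
by rewrite (negbTE (disj j i p _ pj)) ?addn0 ?subn0 // eq_sym.
Qed.

Lemma pfactor_mul_part p m : prime p -> (0 < m)%N -> (p ^ logn p m * m`_p^')%N = m.
Proof. by move=> pr_p m0; rewrite -p_part partnC. Qed.

(** * Reciprocal sums over a class *)

Lemma sum_exprV_le (R : realType) (q : R) N : 1 < q -> \sum_(a < N) q ^- a.+1 <= (q - 1)^-1.
Proof.
move=> q1; have q0 : 0 < q by rewrite (lt_trans ltr01).
suff -> : \sum_(a < N) q ^- a.+1 = (q - 1)^-1 * (1 - q ^- N).
  by rewrite ler_piMr ?invr_ge0 ?subr_ge0 ?(ltW q1) // gerBl invr_ge0 exprn_ge0 // ltW.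
have q1n : q - 1 != 0 by rewrite subr_eq0 gt_eqF.
elim: N => [|N IHN]; first by rewrite big_ord0 expr0 invr1 subrr mulr0.
rewrite big_ord_recr /= IHN exprS.
have qN : q ^+ N != 0 by rewrite expf_neq0 // gt_eqF.
by field; rewrite q1n qN gt_eqF.
Qed.

(** Each multiple of [p] is uniquely [p ^ a * m] with [a > 0] and [p] not dividing [m]; the
    geometric series over [a] produces the weight [1 / (p - 1)] of [HT']. *)
Lemma sum_inv_dvd_prime_le (R : realType) N p (A B : pred nat) : prime p ->
  (forall a m, (0 < a)%N -> (0 < m)%N -> ~~ (p %| m)%N -> A (p ^ a * m)%N -> B m) ->
  \sum_(m < N.+1 | [&& 0 < m, p %| m & A m]%N) (m%:R : R)^-1 <=
    (p%:R - 1)^-1 * \sum_(m < N.+1 | (0 < m)%N && B m) (m%:R : R)^-1.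
Proof.
move=> pr_p AB; have p1 : 1 < p%:R :> R by rewrite ltr1n prime_gt1.
have S_ge0 : 0 <= \sum_(m < N.+1 | (0 < m)%N && B m) (m%:R : R)^-1.
  by apply: sumr_ge0 => m _; rewrite invr_ge0.
apply: le_trans (ler_wpM2r S_ge0 (sum_exprV_le N p1)).
have [->|N0] := posnP N.
  by rewrite big_ord0 mul0r big1 // => m /andP[m0 _]; have := ltn_ord m; lia.
case: N N0 S_ge0 => // N _ _.
rewrite mulr_suml; under [X in _ <= X]eq_bigr do rewrite mulr_sumr.
rewrite pair_big_dep /=.
(* The exponent is stored as its predecessor, to match the terms [q ^- a.+1]. *)
pose g (m : 'I_N.+2) : 'I_N.+1 * 'I_N.+2 := (inord (logn p m).-1, inord m`_p^').
have bd (m : 'I_N.+2) : [&& 0 < m, p %| m & A m]%N ->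
    [/\ 0 < logn p m, nat_of_ord (inord (logn p m).-1 : 'I_N.+1) = (logn p m).-1 &
        nat_of_ord (inord m`_p^' : 'I_N.+2) = m`_p^']%N.
  move=> /and3P[m0 pm _]; have lm : (0 < logn p m)%N by rewrite logn_gt0 mem_primes pr_p m0.
  split=> //; rewrite inordK //; last first.
    by rewrite ltnS (leq_trans (dvdn_leq m0 (dvdn_part _ _))) // -ltnS.
  rewrite prednK // -ltnS; apply: leq_trans (ltn_ord m).
  by rewrite ltnS ltnW // ltn_logl.
apply: (ler_sum_inj (g := g)).
- move=> m1 m2 P1 P2; have [l1 e1 e1'] := bd _ P1; have [l2 e2 e2'] := bd _ P2.
  move=> [] /(congr1 val)/=; rewrite e1 e2 => el /(congr1 val) /=; rewrite e1' e2' => ep.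
  apply/val_inj; case/and3P: P1 => m10 _ _; case/and3P: P2 => m20 _ _.
  rewrite /= -(pfactor_mul_part pr_p m10) -(pfactor_mul_part pr_p m20) ep.
  by congr (p ^ _ * _)%N; lia.
- move=> m Pm; have [l e e'] := bd _ Pm; case/and3P: (Pm) => m0 pm Am /=; rewrite e' part_gt0 /=.
  by apply: (AB (logn p m)); rewrite ?part_gt0 ?pfactor_mul_part // -p'natE // part_pnat.
- move=> m Pm; have [l e e'] := bd _ Pm; case/and3P: (Pm) => m0 pm Am /=; rewrite e e' prednK //.
  by rewrite -invfM -natrX -natrM pfactor_mul_part.
- by move=> j _; rewrite mulr_ge0 ?invr_ge0 ?exprn_ge0.
Qed.

Lemma exprD_ge2terms (R : realDomainType) (h u : R) k : 0 <= h -> 0 <= u ->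
  h ^+ k.+1 + k.+1%:R * u * h ^+ k <= (h + u) ^+ k.+1.
Proof.
move=> h0 u0; elim: k => [|k IHk]; first by rewrite expr0 mulr1 mul1r !expr1.
have := ler_wpM2l (addr_ge0 h0 u0) IHk; rewrite -exprS; apply: le_trans.
have := mulr_ge0 (mulr_ge0 (ler0n R k.+1) (mulr_ge0 u0 u0)) (exprn_ge0 k h0).
rewrite !exprS -[k.+2%:R]natr1; move: (h ^+ k) (k.+1%:R : R) => H K.
lra.
Qed.

(** Induction on the allowed primes. A new prime [p] outside all [T j] multiplies the bound by
    [1 + u], where [u = 1 / (p - 1)]. If [p] is in [T j0], its multiples contribute [u] times the
    sum for [decr k j0], and [h^k / k! + u h^(k-1) / (k-1)! <= (h + u)^k / k!] by the first two
    binomial terms. *)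
Lemma sum_class_inv_smooth_le (R : realType) N r (T : 'I_r -> seq nat) (L : seq nat) k :
  (forall j, uniq (T j)) -> (forall j q, q \in T j -> prime q) ->
  (forall i j q, i != j -> q \in T i -> q \notin T j) -> uniq L -> all prime L ->
  \sum_(m < N.+1 | (0 < m)%N && (all (mem L) (primes m) && in_class T k m)) (m%:R : R)^-1 <=
  \prod_j ((\sum_(p <- L | p \in T j) (p%:R - 1)^-1) ^+ k j / (k j)`!%:R) *
  \prod_(p <- L | [forall j, p \notin T j]) (1 + (p%:R - 1)^-1).
Proof.
move=> uT prT disj; elim: L k => [|p L IHL] k /=.
  move=> _ _; rewrite big_nil mulr1.
  have rhs_ge0 : 0 <= \prod_j ((\sum_(p <- [::] | p \in T j) (p%:R - 1)^-1) ^+ k j /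
      (k j)`!%:R) :> R.
    by apply: prodr_ge0 => j _; rewrite big_nil divr_ge0 ?exprn_ge0.
  (* Without primes only [m = 1] can occur; if it is in the class, all [k j] vanish and each factor
     is [0 ^ 0 / 0! = 1]. *)
  have [in1|notin1] := boolP (in_class T k 1); last first.
    rewrite big1 // => m /andP[m0 /andP[allm inm]].
    move: allm; case Dpm: (primes m) => [|//] _.
    have m1 : nat_of_ord m = 1%N by move/eqP: Dpm; rewrite primes_eq0; lia.
    by rewrite m1 (negbTE notin1) in inm.
  rewrite [X in _ <= X]big1 => [|j _]; last first.
    by move/forallP: in1 => /(_ j); rewrite omegaT1 // => [/eqP<-|q /prT//]; rewrite fact0 divr1.
  have [->|N0] := posnP N.
    by rewrite big1 // => m /andP[m0 _]; have := ltn_ord m; lia.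
  rewrite (bigD1 (Ordinal (N0 : 1 < N.+1)%N)) /= ?in1 // invr1 big1 ?addr0 //.
  move=> m /andP[/andP[m0 /andP[allm inm]]]; rewrite -val_eqE /=.
  move: allm; case Dpm: (primes m) => [|//] _.
  by move/eqP: Dpm; rewrite primes_eq0; lia.
move=> /andP[pL uL] /andP[pr_p prL].
have p1 : 1 < p%:R :> R by rewrite ltr1n prime_gt1.
have u_ge0 : 0 <= (p%:R - 1)^-1 :> R by rewrite invr_ge0 subr_ge0 ltW.
pose S k := \sum_(m < N.+1 | (0 < m)%N && (all (mem L) (primes m) && in_class T k m)) (m%:R : R)^-1.
have S_ge0 k' : 0 <= S k' by apply: sumr_ge0 => m _; rewrite invr_ge0.
rewrite (bigID (fun m : 'I_N.+1 => p %| m)%N) /= addrC.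
have not_dvd : \sum_(m < N.+1 | (0 < m)%N && (all (mem (p :: L)) (primes m) && in_class T k m)
    && ~~ (p %| m)%N) (m%:R : R)^-1 <= S k.
  apply: (ler_sum_inj (g := id)) => // [m|m _]; last by rewrite invr_ge0.
  move=> /andP[/and3P[m0 /allP allm ->] pm]; rewrite m0 andbT /=; apply/allP => q qm.
  have := allm q qm; rewrite !inE => /predU1P[eqp|//].
  by move: qm pm; rewrite eqp mem_primes => /and3P[_ _ ->].
have smooth a m : (0 < a)%N -> (0 < m)%N -> ~~ (p %| m)%N ->
    all (mem (p :: L)) (primes (p ^ a * m)%N) -> all (mem L) (primes m).
  move=> a0 m0 pm /allP allm; apply/allP => q qm.
  have := allm q; rewrite primesM // ?expn_gt0 ?prime_gt0 // qm orbT => /(_ isT).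
  rewrite !inE => /predU1P[eqp|//].
  by move: qm pm; rewrite eqp mem_primes => /and3P[_ _ ->].
have dvd_le k' : (forall a m, (0 < a)%N -> (0 < m)%N -> ~~ (p %| m)%N ->
      in_class T k (p ^ a * m)%N -> in_class T k' m) ->
    \sum_(m < N.+1 | (0 < m)%N && (all (mem (p :: L)) (primes m) && in_class T k m)
      && (p %| m)%N) (m%:R : R)^-1 <= (p%:R - 1)^-1 * S k'.
  move=> kk'; rewrite (eq_bigl (fun m : 'I_N.+1 =>
      [&& 0 < m, p %| m & all (mem (p :: L)) (primes m) && in_class T k m]%N)); last first.
    by move=> m; rewrite -andbA [_ && (p %| m)%N]andbC.
  apply: (@sum_inv_dvd_prime_le R N p
    (fun m => all (mem (p :: L)) (primes m) && in_class T k m)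
    (fun m => all (mem L) (primes m) && in_class T k' m)) => //.
  by move=> a m a0 m0 pm /andP[/(smooth a m a0 m0 pm)-> /(kk' a m a0 m0 pm)->].
have [/forallP pT|/forallPn [j0]] := boolP [forall j, p \notin T j].
  rewrite big_cons; have -> : [forall j, p \notin T j] by apply/forallP.
  under [X in _ <= X * _]eq_bigr do rewrite big_cons (negbTE (pT _)).
  rewrite mulrCA; apply: le_trans (lerD not_dvd (dvd_le k _)) _.
    move=> a m a0 m0 pm inm; have [_] := in_class_split uT prT disj pr_p pm a0 inm.
    by apply; apply/forallP.
  rewrite -{1}[S k]mul1r -mulrDl; apply: ler_wpM2l; first by rewrite addr_ge0.
  exact: IHL.
rewrite negbK => pj0.
rewrite big_cons ifF; last by apply/forallP => /(_ j0); rewrite pj0.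
pose h j : R := \sum_(q <- L | q \in T j) (q%:R - 1)^-1.
have h_ge0 j : 0 <= h j.
  rewrite /h big_seq_cond; apply: sumr_ge0 => q /andP[/(allP prL)/= pr_q _].
  by rewrite invr_ge0 subr_ge0 ler1n prime_gt0.
set Q := \prod_(_ <- L | _) _.
have Q_ge0 : 0 <= Q.
  rewrite /Q big_seq_cond; apply: prodr_ge0 => q /andP[/(allP prL)/= pr_q _].
  by rewrite addr_ge0 // invr_ge0 subr_ge0 ler1n prime_gt0.
pose rest : R := \prod_(j | j != j0) (h j ^+ k j / (k j)`!%:R).
have rest_ge0 : 0 <= rest.
  by apply: prodr_ge0 => j _; rewrite divr_ge0 ?exprn_ge0.
have -> : \prod_j ((\sum_(q <- p :: L | q \in T j) (q%:R - 1)^-1) ^+ k j / (k j)`!%:R) =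
    (h j0 + (p%:R - 1)^-1) ^+ k j0 / (k j0)`!%:R * rest.
  rewrite (bigD1 j0) //= big_cons pj0 [X in X ^+ _]addrC; congr (_ * _).
  apply: eq_bigr => j neq_j; rewrite big_cons (negbTE (disj _ _ _ _ pj0)) // eq_sym //.
have Sk : S k <= h j0 ^+ k j0 / (k j0)`!%:R * rest * Q.
  by have := IHL k uL prL; rewrite (bigD1 j0).
case Dk: (k j0) => [|l].
  (* With [k j0 = 0] no multiple of [p] is in the class. *)
  rewrite [X in _ + X]big1 ?addr0; last first.
    move=> m /andP[/and3P[m0 _ inm] pm].
    have pm' : ~~ (p %| m`_p^')%N by rewrite -p'natE // part_pnat.
    have lm : (0 < logn p m)%N by rewrite logn_gt0 mem_primes pr_p m0.
    rewrite -(pfactor_mul_part pr_p m0) in inm.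
    by have [/(_ j0 pj0)] := in_class_split uT prT disj pr_p pm' lm inm; rewrite Dk.
  by move: Sk; rewrite Dk; apply: le_trans.
apply: le_trans (lerD not_dvd (dvd_le (decr k j0) _)) _.
  move=> a m a0 m0 pm inm; have [/(_ j0 pj0)] := in_class_split uT prT disj pr_p pm a0 inm.
  by case/andP.
have Sd : S (decr k j0) <= h j0 ^+ l / l`!%:R * rest * Q.
  have <- : \prod_(j | j != j0) (h j ^+ decr k j0 j / (decr k j0 j)`!%:R) = rest.
    by apply: eq_bigr => j neq_j; rewrite /decr (negbTE neq_j) subn0.
  have <- : decr k j0 j0 = l by rewrite /decr eqxx Dk subn1.
  by have := IHL (decr k j0) uL prL; rewrite (bigD1 j0).
apply: le_trans (lerD Sk (ler_wpM2l u_ge0 Sd)) _.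
rewrite Dk !mulrA -!mulrDl; apply: ler_wpM2r => //; apply: ler_wpM2r => //.
have fl : l.+1%:R != 0 :> R by rewrite pnatr_eq0.
have fl2 : l`!%:R != 0 :> R by rewrite pnatr_eq0 -lt0n fact_gt0.
have -> : h j0 ^+ l.+1 / l.+1`!%:R + (p%:R - 1)^-1 * h j0 ^+ l / l`!%:R =
   (h j0 ^+ l.+1 + l.+1%:R * (p%:R - 1)^-1 * h j0 ^+ l) / l.+1`!%:R.
  rewrite factS natrM; move: (l.+1%:R : R) fl ((p%:R - 1)^-1 : R) => x x0 y.
  by field; rewrite ?x0 ?fl2.
by apply: ler_wpM2r; rewrite ?invr_ge0 // exprD_ge2terms.
Qed.

Definition class_sum (R : realType) N r (T : 'I_r -> seq nat) (k : 'I_r -> nat) : R :=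
  \sum_(m < N.+1 | (0 < m)%N && in_class T k m) m%:R^-1.

(** Take [L] to be all primes up to [N]: every [m <= N] then satisfies the smoothness condition. *)
Lemma sum_class_inv_le (R : realType) N r (T : 'I_r -> seq nat) k :
  (forall j, uniq (T j)) -> (forall j q, q \in T j -> prime q && (q <= N)%N) ->
  (forall i j q, i != j -> q \in T i -> q \notin T j) ->
  class_sum R N T k <=
  \prod_j (HT' (T j) ^+ k j / (k j)`!%:R) *
  \prod_(0 <= p < N.+1 | prime p && [forall j, p \notin T j]) (1 + (p%:R - 1)^-1).
Proof.
move=> uT prT disj.
pose L := [seq p <- index_iota 0 N.+1 | prime p].
have uL : uniq L by rewrite filter_uniq // iota_uniq.
have prL : all prime L by apply: filter_all.
have prT' j q : q \in T j -> prime q by case/prT/andP.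
have := @sum_class_inv_smooth_le R N r T L k uT prT' disj uL prL.
rewrite big_filter_cond; congr (_ <= _ * _).
  apply: eq_bigl => m; congr (_ && _); rewrite andb_idl // => _; apply/allP => q.
  rewrite mem_primes => /and3P[pr_q m0 /(dvdn_leq m0) qm].
  by rewrite /= mem_filter pr_q mem_index_iota /= (leq_ltn_trans qm).
apply: eq_bigr => j _; congr (_ ^+ _ / _).
rewrite /HT' (@sum_mem_index_iota _ (T j) 0 N.+1) // => [|q /prT/andP[]//].
by rewrite big_filter_cond; apply: eq_bigl => q; apply/andb_idl; apply: prT'.
Qed.

(** * Counting a class with logarithmic weights *)

(** Each summand is [ln p^a + ln (N / n)] with [p^a] exactly dividing [n]. The first parts add up to
    [ln n], and the nonnegative [ln (N / n)] occurs at least once since [n > 1] has a prime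
    divisor. *)
Lemma ln_le_sum_prime_cofactors (R : realType) N n : (1 < n <= N)%N ->
  ln (N%:R : R) <= \sum_(p < N.+1 | prime p && (p %| n)%N) ln (N%:R / (n`_p^')%:R).
Proof.
move=> /andP[n1 nN]; have n0 : (0 < n)%N by apply: ltnW.
have N0 : (0 < N)%N by apply: leq_trans nN.
have ln_n : ln (n%:R : R) = \sum_(p < N.+1 | prime p && (p %| n)%N) ln ((n`_p)%:R).
  rewrite -{1}(partnT n0) (widen_partn _ nN) big_mkord ln_prod_nat => [|p _]; last first.
    by rewrite -p_part part_gt0.
  rewrite [RHS]big_mkcond; apply: eq_bigr => p _; rewrite p_part lognE n0.
  by case: (prime p); case: (p %| n)%N => //=; rewrite expn0 ln1.
have pos m : (0 < m)%N -> (m%:R : R) \is Num.pos by rewrite posrE ltr0n.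
rewrite (eq_bigr (fun p : 'I_N.+1 => ln ((n`_p)%:R) + ln (N%:R / n%:R))); last first.
  move=> p _; rewrite !ln_div ?pos ?part_gt0 //.
  have -> : ln (n%:R : R) = ln (n`_p)%:R + ln (n`_p^')%:R.
    by rewrite -lnM ?pos ?part_gt0 // -natrM partnC.
  by lra.
rewrite big_split /= -ln_n sumr_const ln_div ?pos //.
rewrite -[X in _ + X]mulr_natl -lerBlDl ler_peMl // ?subr_ge0.
  by apply: ln_le; rewrite ?ltr0n ?ler_nat.
have pN : (pdiv n < N.+1)%N by rewrite ltnS (leq_trans (pdiv_leq n0)).
rewrite ler1n; apply/card_gt0P; exists (Ordinal pN).
by rewrite unfold_in /= pdiv_prime // pdiv_dvd.
Qed.

Lemma card_prime_powers_le N m : (0 < m)%N ->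
  (\sum_(p < N.+1 | prime p) \sum_(a < N.+1 | (0 < a) && (p ^ a * m <= N)) 1 <=
   \sum_(0 <= p < (N %/ m).+1 | prime p) trunc_log p (N %/ m))%N.
Proof.
move=> m0; set M := (N %/ m)%N.
have MN : (M <= N)%N by apply: leq_div.
have -> : (\sum_(0 <= p < M.+1 | prime p) trunc_log p M =
    \sum_(p < N.+1 | prime p) trunc_log p M)%N.
  rewrite -(big_mkord prime (fun p => trunc_log p M)) [RHS](@big_cat_nat _ _ _ M.+1) //=.
  rewrite [X in (_ + X)%N]big_nat_cond [X in (_ + X)%N]big1 ?addn0 // => p /andP[/andP[Mp _] pr_p].
  by apply/eqP; rewrite trunc_log_eq0; lia.
apply: leq_sum => p pr_p.
rewrite sum1_card cardE -(size_map val) -(size_iota 1 (trunc_log p M)).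
apply: uniq_leq_size; first by rewrite map_inj_uniq ?enum_uniq //; exact: val_inj.
move=> _ /mapP[a + ->]; rewrite mem_enum unfold_in => /andP[a0 pa].
rewrite mem_iota /= a0 add1n ltnS trunc_log_max ?prime_gt1 // leq_divRL //.
Qed.

(** The sum over [(n, p)] is regrouped by the cofactor [m]. For fixed [m] there are
    [O((N / m) / ln (N / m))] prime powers [p ^ a <= N / m], each weighted by [ln (N / m)], which
    leaves [O(N / m)]. *)
Lemma class_count_ln_le (R : realType) : exists2 C : R, 0 < C &
  forall N r (T : 'I_r -> seq nat) (k : 'I_r -> nat) (eta : R),
  (forall j, uniq (T j)) -> (forall j q, q \in T j -> prime q) ->
  (forall i j q, i != j -> q \in T i -> q \notin T j) -> 0 <= eta ->
  (forall p, prime p -> (p <= N)%N -> [forall j, p \notin T j] -> 1 <= eta) ->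
  \sum_(n < N.+1 | (1 < n)%N && in_class T k n) ln (N%:R : R) <=
  C * N%:R * (eta * class_sum R N T k + \sum_j (0 < k j)%:R * class_sum R N T (decr k j)).
Proof.
have [C C0 count_le] := prime_powers_count_le R; exists C => //.
move=> N r T k eta uT prT disj eta0 eta1; set S := class_sum R N T.
(* [w m >= 1] whenever [m] is such a cofactor of a class member: through [eta] if [p] is in no
   [T j], through the [j]-th summand if [p] is in [T j]. *)
pose w (m : nat) : R := eta * (in_class T k m)%:R +
  \sum_j ((0 < k j)%N && in_class T (decr k j) m)%:R.
have w0 m : 0 <= w m by rewrite addr_ge0 ?mulr_ge0 // sumr_ge0.
have -> : eta * S k + \sum_j (0 < k j)%:R * S (decr k j) =
    \sum_(m < N.+1 | (0 < m)%N) w m / m%:R.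
  have SE k' : S k' = \sum_(m < N.+1 | (0 < m)%N) (in_class T k' m)%:R / m%:R.
    rewrite /S /class_sum big_mkcondr; apply: eq_bigr => m _.
    by case: ifP; rewrite ?mul1r ?mul0r.
  rewrite SE mulr_sumr; under [X in _ + X = _]eq_bigr do rewrite SE mulr_sumr.
  rewrite exchange_big -big_split /=; apply: eq_bigr => m _.
  rewrite /w mulrDl mulrA; congr (_ + _); rewrite mulr_suml; apply: eq_bigr => j _.
  by rewrite mulrA -natrM mulnb.
have lnNm m : (0 < m <= N)%N -> 0 <= ln (N%:R / m%:R) :> R.
  by move=> /andP[m0 mN]; rewrite ln_ge0 // ler_pdivlMr ?ltr0n // mul1r ler_nat.
apply: (@le_trans _ _ (\sum_(n < N.+1 | (1 < n)%N && in_class T k n)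
    \sum_(p < N.+1 | prime p && (p %| n)%N) ln (N%:R / (n`_p^')%:R))).
  apply: ler_sum => n /andP[n1 _]; apply: ln_le_sum_prime_cofactors.
  by rewrite n1 -ltnS ltn_ord.
rewrite pair_big_dep /=.
apply: (@le_trans _ _ (\sum_(m < N.+1 | (0 < m)%N) \sum_(p < N.+1 | prime p)
   \sum_(a < N.+1 | ((0 < a) && (p ^ a * m <= N))%N) w m * ln (N%:R / m%:R))); last first.
  rewrite mulr_sumr; apply: ler_sum => m m0.
  have mN : (m <= N)%N by rewrite -ltnS.
  have := card_prime_powers_le N m0; set c := (\sum_(p < _ | _) _)%N.
  move=> c_le.
  rewrite (_ : \sum_(p < _ | _) _ = c%:R * (w m * ln (N%:R / m%:R))); last first.
    rewrite /c natr_sum mulr_suml; apply: eq_bigr => p _.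
    by rewrite natr_sum mulr_suml; apply: eq_bigr => a _; rewrite mul1r.
  rewrite mulrCA [X in _ <= X]mulrCA; apply: ler_wpM2l => //.
  have Nm : N%:R / m%:R <= (N %/ m).+1%:R :> R.
    by rewrite ler_pdivrMr ?ltr0n // -natrM ler_nat ltnW // ltn_ceil.
  apply: (@le_trans _ _ (c%:R * ln (N %/ m).+1%:R)).
    apply: ler_wpM2l => //; apply: ln_le => //.
    by rewrite divr_gt0 ?ltr0n // (leq_trans m0).
  apply: (@le_trans _ _ (C * (N %/ m)%:R)).
    apply: le_trans (count_le _); apply: ler_wpM2r; last by rewrite ler_nat.
    by rewrite ln_ge0 // ler1n.
  rewrite -mulrA ler_pM2l // ler_pdivlMr ?ltr0n // -natrM ler_nat; exact: leq_trunc_div.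
under [X in _ <= X]eq_bigr do rewrite pair_big_dep /=.
rewrite [X in _ <= X]pair_big_dep /=.
(* [(n, p)] goes to [(m, (p, a))] with [n = p ^ a * m], from which [n] is recovered. *)
pose g (np : 'I_N.+1 * 'I_N.+1) : 'I_N.+1 * ('I_N.+1 * 'I_N.+1) :=
  (inord (nat_of_ord np.1)`_(nat_of_ord np.2)^', (np.2, inord (logn np.2 np.1))).
have bd (np : 'I_N.+1 * 'I_N.+1) : (1 < np.1)%N && in_class T k np.1 &&
      (prime np.2 && (np.2 %| np.1)%N) ->
    [/\ 0 < logn np.2 np.1, (0 < np.1)%N,
        nat_of_ord (inord (logn np.2 np.1) : 'I_N.+1) = logn np.2 np.1 &
        nat_of_ord (inord (nat_of_ord np.1)`_(nat_of_ord np.2)^' : 'I_N.+1) =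
          (nat_of_ord np.1)`_(nat_of_ord np.2)^']%N.
  case: np => n p /= /andP[/andP[n1 _] /andP[pr_p pn]].
  have n0 : (0 < n)%N by apply: ltnW.
  have lm : (0 < logn p n)%N by rewrite logn_gt0 mem_primes pr_p n0.
  split=> //; rewrite inordK //.
    by apply: leq_ltn_trans (ltn_ord n); rewrite ltnW // ltn_logl.
  by rewrite ltnS (leq_trans (dvdn_leq n0 (dvdn_part _ _))) // -ltnS.
apply: (ler_sum_inj (g := g)).
- move=> np1 np2 P1 P2; have [l1 n1 e1 e1'] := bd _ P1; have [l2 n2 e2 e2'] := bd _ P2.
  move=> [] /(congr1 val) /= + ep /(congr1 val) /=; rewrite e1 e2 e1' e2' ep => em el.
  case/andP: P1 => _ /andP[pr1 _]; case/andP: P2 => _ /andP[pr2 _].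
  have eqn : np1.1 = np2.1.
    by apply/val_inj; rewrite /= -(pfactor_mul_part pr2 n1) -(pfactor_mul_part pr2 n2) em el.
  by rewrite [np1]surjective_pairing [np2]surjective_pairing ep eqn.
- move=> np Pnp; have [l n0 e e'] := bd _ Pnp; case/andP: Pnp => /andP[_ _] /andP[pr_p pn].
  by rewrite /= e e' part_gt0 pr_p l pfactor_mul_part // -ltnS ltn_ord.
- move=> np Pnp; have [l n0 e e'] := bd _ Pnp; case/andP: Pnp => /andP[_ inn] /andP[pr_p pn].
  rewrite /= e'; set m := ((nat_of_ord np.1)`_(nat_of_ord np.2)^')%N.
  have m0 : (0 < m)%N by apply: part_gt0.
  have mN : (m <= N)%N by rewrite (leq_trans (dvdn_leq n0 (dvdn_part _ _))) // -ltnS.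
  apply: ler_peMl; first by rewrite lnNm // m0.
  have pm : ~~ (np.2 %| m)%N by rewrite -p'natE // part_pnat.
  rewrite -(pfactor_mul_part pr_p n0) in inn.
  have [inj inT] := in_class_split uT prT disj pr_p pm l inn.
  have [pT|/forallPn[j]] := boolP [forall j, nat_of_ord np.2 \notin T j].
    rewrite /w inT // mulr1 -[X in X <= _]addr0 lerD ?sumr_ge0 //.
    by apply: eta1 pr_p _ pT; rewrite -ltnS.
  rewrite negbK => /inj inj_m; rewrite /w (bigD1 j) //= inj_m.
  by rewrite addrCA lerDl addr_ge0 ?mulr_ge0 ?sumr_ge0.
- move=> [m [p a]] /= /andP[m0 _]; rewrite mulr_ge0 // lnNm // m0 /= -ltnS //.
Qed.

(** * Comparing [HT], [HT'] and Euler products *)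

(** The differences [1 / (p - 1) - 1 / p] are nonnegative and telescope to at most 1 over all
    integers from 2 on. *)
Lemma HT'_le (R : realType) (T : seq nat) :
  uniq T -> (forall q, q \in T -> prime q) -> HT' T <= HT T + 1 :> R.
Proof.
move=> uT prT; rewrite -lerBlDl /HT' /HT -sumrB.
pose B := (\max_(q <- T) q).
rewrite (@sum_mem_index_iota _ T 2 B.+3) // => [|q qT]; last first.
  by rewrite prime_gt1 ?prT //= !ltnS !leqW // /B leq_bigmax_seq.
apply: (@le_trans _ _ (\sum_(2 <= p < B.+3) ((p%:R - 1)^-1 - p%:R^-1 : R))).
  rewrite big_mkcond big_nat [X in _ <= X]big_nat; apply: ler_sum => p /andP[p2 _].
  have p0 : 0 < p%:R - 1 :> R by rewrite subr_gt0 ltr1n.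
  have d_ge0 : 0 <= (p%:R - 1)^-1 - p%:R^-1 :> R.
    rewrite subr_ge0 lef_pV2 ?posrE ?ltr0n //; last by lia.
    by rewrite gerBl.
  by case: ifP.
suff -> : forall b, \sum_(2 <= p < b.+3) ((p%:R - 1)^-1 - p%:R^-1 : R) = 1 - b.+2%:R^-1.
  by rewrite gerBl invr_ge0.
have predr b : b.+1%:R - 1 = b%:R :> R by rewrite -[b.+1%:R]natr1 addrK.
elim=> [|b IHb]; first by rewrite big_nat1 predr invr1.
by rewrite big_nat_recr //= IHb predr addrA subrK.
Qed.

Lemma HT'_gt0 (R : realType) (T : seq nat) :
  T != [::] -> (forall q, q \in T -> prime q) -> 0 < HT' T :> R.
Proof.
case: T => // p T _ prT; have inv_ge0 q : prime q -> 0 < (q%:R - 1)^-1 :> R.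
  by move=> pr_q; rewrite invr_gt0 subr_gt0 ltr1n prime_gt1.
rewrite /HT' big_cons ltr_pwDl ?inv_ge0 ?prT ?mem_head // big_seq sumr_ge0 // => q qT.
by rewrite ltW // inv_ge0 // prT // in_cons qT orbT.
Qed.

(** By disjointness each prime up to [N] is counted once on the left. This is how Mertens' bound
    yields the factors [expR (- HT (T j))]. *)
Lemma HT_cofactor_le (R : realType) N r (T : 'I_r -> seq nat) :
  (forall j, uniq (T j)) -> (forall j q, q \in T j -> prime q && (q <= N)%N) ->
  (forall i j q, i != j -> q \in T i -> q \notin T j) ->
  HT [seq p <- index_iota 0 N.+1 | prime p & [forall j, p \notin T j]] + \sum_j HT (T j) <=
  \sum_(0 <= p < N.+1 | prime p) p%:R^-1 :> R.
Proof.
move=> uT prT disj; rewrite /HT big_filter.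
under [X in _ + X]eq_bigr => j _.
  rewrite (@sum_mem_index_iota _ (T j) 0 N.+1) //; last by move=> q /prT/andP[].
  rewrite big_mkcond.
  over.
rewrite exchange_big big_mkcond [X in _ <= X]big_mkcond -big_split /=.
apply: ler_sum => p _.
have [pT|/forallPn [j]] := boolP [forall j, p \notin T j].
  rewrite big1 ?addr0 ?andbT // => j _.
  by rewrite (negbTE (forallP pT j)).
rewrite negbK andbF => pj; have /andP[-> _] := prT _ _ pj.
rewrite add0r (bigD1 j) //= pj big1 ?addr0 // => i neq_ij.
by rewrite (negbTE (disj j i p _ pj)) // eq_sym.
Qed.

(** [1 + u <= exp u] gives [expR (HT' L)]; passing from [HT'] to [HT] costs the factor [expR 1]. *)
Lemma cofactor_prod_le (R : realType) (L : seq nat) : uniq L -> all prime L ->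
  \prod_(p <- L) (1 + (p%:R - 1)^-1) <= expR 1 * expR (HT L) :> R.
Proof.
move=> uL prL; rewrite -expRD addrC.
apply: (@le_trans _ _ (expR (HT' L))); last by rewrite ler_expR HT'_le //; apply/allP.
rewrite expR_sum big_seq [X in _ <= X]big_seq; apply: ler_prod => p /(allP prL) /= pr_p.
by rewrite expR_ge1Dx addr_ge0 // invr_ge0 subr_ge0 ler1n prime_gt0.
Qed.

Lemma prod_1D_ge (R : realDomainType) (I : Type) (s : seq I) (x : I -> R) :
  (forall i, 0 <= x i) -> 1 + \sum_(i <- s) x i <= \prod_(i <- s) (1 + x i).
Proof.
move=> x0.
elim: s => [|i s IHs]; first by rewrite !big_nil addr0.
have s0 : 0 <= \sum_(i <- s) x i by apply: sumr_ge0.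
rewrite !big_cons; apply: le_trans (ler_wpM2l _ IHs); last by rewrite addr_ge0.
by have := mulr_ge0 (x0 i) s0; lra.
Qed.

(** Separates [n = 1], which has no prime divisor and escapes the logarithmic argument. *)
Lemma count_iota1 (E : pred nat) N : (0 < N)%N ->
  count E (iota 1 N) = (E 1 + \sum_(n < N.+1 | (1 < n) && E n) 1)%N.
Proof.
case: N => // N _; rewrite /= -sum1_count; congr (_ + _)%N.
rewrite (eq_bigl (fun n : 'I_N.+2 => E n && (1 < n)%N)) => [|n]; last by rewrite andbC.
by rewrite -(big_geq_mkord 2 N.+2 E (fun=> 1%N)) /index_iota !subSS subn0.
Qed.

(** Lowering a positive exponent [k j] by one multiplies [HT' (T j) ^+ k j / (k j)!] by
    [k j / HT' (T j)]. *)
Lemma class_sum_le (R : realType) N r (T : 'I_r -> seq nat) (k : 'I_r -> nat) (eta Q : R) :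
  (forall j, uniq (T j)) -> (forall j, T j != [::]) ->
  (forall j q, q \in T j -> prime q && (q <= N)%N) ->
  (forall i j q, i != j -> q \in T i -> q \notin T j) -> 0 <= eta ->
  \prod_(0 <= p < N.+1 | prime p && [forall j, p \notin T j]) (1 + (p%:R - 1)^-1) <= Q ->
  eta * class_sum R N T k + \sum_j (0 < k j)%:R * class_sum R N T (decr k j) <=
  \prod_j (HT' (T j) ^+ k j / (k j)`!%:R) * Q * (eta + \sum_j (k j)%:R / HT' (T j)).
Proof.
move=> uT T0 prT disj eta0 Q_le.
have H'0 j : 0 < HT' (T j) :> R by apply: HT'_gt0 => // q /prT/andP[].
have D0 k' : 0 <= \prod_j (HT' (T j) ^+ k' j / (k' j)`!%:R) :> R.
  by apply: prodr_ge0 => j _; rewrite divr_ge0 // exprn_ge0 // ltW.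
have S_le k' : class_sum R N T k' <= \prod_j (HT' (T j) ^+ k' j / (k' j)`!%:R) * Q.
  by apply: le_trans (sum_class_inv_le R _ uT prT disj) _; apply: ler_wpM2l.
rewrite mulrDr [X in _ <= X + _]mulrC [X in _ <= _ + X]mulr_sumr; apply: lerD.
  exact: ler_wpM2l.
apply: ler_sum => j _; have [->|k0] := posnP (k j); first by rewrite !mul0r mulr0.
rewrite mul1r; apply: le_trans (S_le _) _; rewrite [X in _ <= X]mulrAC.
have Q0 : 0 <= Q.
  apply: le_trans Q_le; apply: prodr_ge0 => p /andP[pr_p _].
  by rewrite addr_ge0 // invr_ge0 subr_ge0 ler1n prime_gt0.
apply: ler_wpM2r => //; rewrite le_eqVlt; apply/orP; left; apply/eqP.
rewrite (bigD1 j) //= [in RHS](bigD1 j) //= mulrAC; congr (_ * _); last first.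
  by apply: eq_bigr => i neq_ij; rewrite /decr (negbTE neq_ij) subn0.
rewrite /decr eqxx; case: (k j) k0 => // l _; rewrite subn1 /= factS natrM exprS.
have h0 : HT' (T j) != 0 :> R by rewrite gt_eqF.
have fl : l.+1%:R != 0 :> R by rewrite pnatr_eq0.
have fl2 : l`!%:R != 0 :> R by rewrite pnatr_eq0 -lt0n fact_gt0.
move: (l.+1%:R : R) fl => x x0.
by field; rewrite ?x0 ?fl2 ?h0.
Qed.

(** Reduces the second bound to the first: [1 + \sum_j y_j <= \prod_j (1 + y_j)] with
    [y_j = k_j / H'_j], then [H'^k (1 + k / H') <= (H' + 1)^k <= (H + 2)^k]. *)
Lemma prod_HT'_le (R : realType) r (T : 'I_r -> seq nat) (k : 'I_r -> nat) :
  (forall j, uniq (T j)) -> (forall j, T j != [::]) -> (forall j q, q \in T j -> prime q) ->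
  \prod_j (HT' (T j) ^+ k j / (k j)`!%:R) * (1 + \sum_j (k j)%:R / HT' (T j)) <=
  \prod_j ((HT (T j) + 2) ^+ k j / (k j)`!%:R) :> R.
Proof.
move=> uT T0 prT.
have H'0 j : 0 < HT' (T j) :> R by apply: HT'_gt0 => // q /prT.
have D0 : 0 <= \prod_j (HT' (T j) ^+ k j / (k j)`!%:R) :> R.
  by apply: prodr_ge0 => j _; rewrite divr_ge0 // exprn_ge0 // ltW.
have x0 j : 0 <= (k j)%:R / HT' (T j) :> R by rewrite divr_ge0 // ltW.
apply: le_trans (ler_wpM2l D0 (prod_1D_ge _ x0)) _.
rewrite -big_split /=; apply: ler_prod => j _.
rewrite mulr_ge0 ?addr_ge0 ?divr_ge0 ?exprn_ge0 ?(ltW (H'0 j)) //= mulrAC.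
apply: ler_wpM2r; first by rewrite invr_ge0.
apply: (@le_trans _ _ ((HT' (T j) + 1) ^+ k j)); last first.
  have h0 := H'0 j; have hle := @HT'_le R _ (uT j) (prT j).
  by apply: lerXn2r; rewrite ?nnegrE; lra.
case: (k j) => [|l]; first by rewrite mul0r addr0 mulr1 !expr0.
apply: le_trans (exprD_ge2terms _ _ _); rewrite ?(ltW (H'0 j)) // mulr1 mulrDr mulr1 lerD2l exprS.
move: (l.+1%:R : R) => y; rewrite le_eqVlt; apply/orP; left; apply/eqP.
by field; rewrite gt_eqF.
Qed.

(** * Assembling the two bounds *)

Theorem theorem2 :
  exists C : Rdefinitions.R, forall (x : Rdefinitions.R) (r : nat)
    (T : 'I_r -> seq nat) (k : 'I_r -> nat),
    2 <= x -> (0 < r)%N ->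
    (forall j, uniq (T j)) ->
    (forall j, T j != [::]) ->
    (forall j p, p \in T j -> prime p && (p%:R <= x)) ->
    (forall i j p, i != j -> p \in T i -> p \notin T j) ->
    let P := probx x (fun n => [forall j, omegaT n (T j) == k j]) in
    let eta : Rdefinitions.R :=
      if [forall p : 'I_(Nx x).+1, prime p ==> [exists j, (val p \in T j)]]
      then 0 else 1 in
    let xi : Rdefinitions.R :=
      if (eta == 0) && [forall j, k j == 0%N] then 1 else 0 in
    P <= C * (\prod_(j < r) ((HT' (T j)) ^+ (k j) / ((k j)`!)%:R * expR (- HT (T j))))
             * (eta + \sum_(j < r) (k j)%:R / HT' (T j)) + C * xi
    /\
    P <= C * \prod_(j < r) ((HT (T j) + 2) ^+ (k j) / ((k j)`!)%:R * expR (- HT (T j))).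
Proof.
pose R : realType := Rdefinitions.R.
have [C1 C1_gt0 count_le] := class_count_ln_le R.
have [C2 C2_gt0 mertens] := mertens_upper R.
pose A : R := C1 * (expR 1 * C2).
have A_gt0 : 0 < A by rewrite /A !mulr_gt0 ?expR_gt0.
(* [A] pays for the integers [n > 1], [C2] for [n = 1] via Mertens, and 1 for [n = 1] when
   [xi = 1]. *)
exists (A + C2 + 1) => x r T k x2 r0 uT T0 prTx disj P eta xi.
pose N := Nx x.
have x0 : 0 <= x by rewrite (le_trans _ x2).
have N2 : (1 < N)%N by rewrite /N /Nx truncn_gt_nat.
have N0 : (0 < N)%N by apply: ltnW.
have prT j q : q \in T j -> prime q && (q <= N)%N.
  by move=> /prTx; rewrite /N /Nx truncn_ge_nat.
have prT' j q : q \in T j -> prime q by case/prT/andP.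
have eta01 : (eta == 0) || (eta == 1) by rewrite /eta; case: ifP; rewrite eqxx ?orbT.
have eta0 : 0 <= eta by case/orP: eta01 => /eqP->.
have eta_le1 : eta <= 1 by case/orP: eta01 => /eqP->.
have eta1 p : prime p -> (p <= N)%N -> [forall j, p \notin T j] -> 1 <= eta.
  move=> pr_p pN /forallP pT; rewrite /eta ifF //; apply/negP => /forallP.
  rewrite -ltnS in pN => /(_ (Ordinal pN)); rewrite /= pr_p => /existsP[j] /=.
  by rewrite (negbTE (pT j)).
have lnN : 0 < ln N%:R :> R by rewrite ln_gt0 // ltr1n.
have NR0 : 0 < N%:R :> R by rewrite ltr0n.
pose D : R := \prod_j (HT' (T j) ^+ k j / (k j)`!%:R).
pose X : R := \prod_j expR (- HT (T j)).
pose W : R := eta + \sum_j (k j)%:R / HT' (T j).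
pose Z : R := \prod_j ((HT (T j) + 2) ^+ k j / (k j)`!%:R).
have XE : X = expR (- \sum_j HT (T j)) by rewrite /X -sumrN expR_sum.
have X_gt0 : 0 < X by rewrite XE expR_gt0.
have H'0 j : 0 < HT' (T j) :> R by apply: HT'_gt0 => // q /prT'.
have D_ge0 : 0 <= D by apply: prodr_ge0 => j _; rewrite divr_ge0 // exprn_ge0 // ltW.
have K_ge0 : 0 <= \sum_j (k j)%:R / HT' (T j) :> R.
  by apply: sumr_ge0 => j _; rewrite divr_ge0 // ltW.
have W_ge0 : 0 <= W by rewrite addr_ge0.
have DWZ : D * W <= Z.
  apply: le_trans (@prod_HT'_le R r T k uT T0 prT'); apply: ler_wpM2l => //.
  by rewrite lerD2r.
have Z_ge0 : 0 <= Z by apply: le_trans DWZ; rewrite mulr_ge0.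
have Q_le : \prod_(0 <= p < N.+1 | prime p && [forall j, p \notin T j]) (1 + (p%:R - 1)^-1)
    <= expR 1 * C2 * ln N%:R * X :> R.
  rewrite -big_filter; set L := [seq _ <- _ | _].
  apply: le_trans (cofactor_prod_le R _ _) _.
  - by rewrite filter_uniq // iota_uniq.
  - by apply/allP => q; rewrite mem_filter => /andP[/andP[]].
  rewrite -!mulrA ler_pM2l ?expR_gt0 // mulrA.
  apply: (@le_trans _ _ (expR (\sum_(0 <= p < N.+1 | prime p) p%:R^-1) * X)).
    by rewrite XE -expRD ler_expR lerBrDr HT_cofactor_le.
  by rewrite ler_pM2r // mertens.
(* All [T j] together have reciprocal sum at most that of the primes up to [N], so
   [1 <= C2 * ln N * X]; then [ln N <= N]. *)
have one_le : 1 / N%:R <= C2 * X.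
  rewrite ler_pdivrMr //.
  apply: (@le_trans _ _ (C2 * ln N%:R * X)); last first.
    rewrite mulrAC ler_pM2l ?mulr_gt0 // ltW // ln_sublinear //.
  apply: le_trans (_ : expR (\sum_(0 <= p < N.+1 | prime p) p%:R^-1) * X <= _); last first.
    by rewrite ler_pM2r // mertens.
  rewrite XE -expRD -[X in X <= _]expR0 ler_expR subr_ge0.
  apply: le_trans (@HT_cofactor_le R N r T uT prT disj); rewrite lerDr.
  by apply: sumr_ge0 => p _; rewrite invr_ge0.
pose c : R := (\sum_(n < N.+1 | (1 < n)%N && in_class T k n) 1)%N%:R.
have PE : P = (in_class T k 1)%:R / N%:R + c / N%:R.
  by rewrite /P /probx -/N count_iota1 // natrD mulrDl.
have c_le : c / N%:R <= A * (D * W * X).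
  rewrite ler_pdivrMr // -(ler_pM2r lnN).
  have -> : c * ln N%:R = \sum_(n < N.+1 | (1 < n)%N && in_class T k n) ln (N%:R : R).
    by rewrite /c natr_sum mulr_suml; apply: eq_bigr => n _; rewrite mul1r.
  apply: le_trans (count_le N r T k eta uT prT' disj eta0 eta1) _.
  have := @class_sum_le R N r T k eta _ uT T0 prT disj eta0 Q_le.
  rewrite -/D -/W -(ler_pM2l (_ : 0 < C1 * N%:R)) ?mulr_gt0 // => /le_trans; apply.
  rewrite le_eqVlt; apply/orP; left; apply/eqP; rewrite /A; ring.
have k0 : in_class T k 1 -> forall j, k j = 0%N.
  by move=> /forallP in1 j; move: (in1 j); rewrite omegaT1 => [/eqP<-|q /prT'].
(* If 1 is in the class, all [k j] vanish and [Z = 1]. *)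
have b_le : (in_class T k 1)%:R / N%:R <= C2 * (Z * X).
  have [in1|_] := boolP (in_class T k 1); last first.
    by rewrite mul0r !mulr_ge0 // ltW.
  have -> : Z = 1 by rewrite /Z big1 // => j _; rewrite k0 // fact0 divr1.
  by rewrite mul1r.
rewrite big_split [X in _ /\ _ <= _ * X]big_split /= -/D -/X -/Z -/W -/xi PE; split; last first.
  rewrite [X in X <= _]addrC mulrDl mul1r; apply: ler_wpDr.
    by rewrite mulr_ge0 // ltW.
  rewrite mulrDl; apply: lerD => //; apply: le_trans c_le _.
  by rewrite ler_pM2l // ler_pM2r.
have DXW_ge0 : 0 <= D * X * W by rewrite !mulr_ge0 // ltW.
have xi_ge0 : 0 <= xi by rewrite /xi; case: ifP.
have {}c_le : c / N%:R <= A * (D * X * W) by rewrite [D * X * W]mulrAC.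
suff : (in_class T k 1)%:R / N%:R <= C2 * (D * X * W) + xi.
  have := mulr_ge0 (ltW A_gt0) xi_ge0; have := mulr_ge0 (ltW C2_gt0) xi_ge0.
  rewrite -[_ * (D * X) * W]mulrA; lra.
have [in1|_] := boolP (in_class T k 1); last by rewrite mul0r addr_ge0 // mulr_ge0 // ltW.
have D1 : D = 1 by rewrite /D big1 // => j _; rewrite k0 // fact0 divr1.
(* Here all [k j = 0]. If [eta = 0] then [xi = 1] absorbs [1 / N <= 1]; if [eta = 1] then
   [D = W = 1] and [one_le] applies. *)
case/orP: eta01 => /eqP eta_eq.
  rewrite /xi eta_eq eqxx (_ : [forall j, k j == 0%N]) /=; last first.
    by apply/forallP => j; rewrite k0.
  apply: ler_wpDl; first by rewrite mulr_ge0 // ltW.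
  by rewrite ler_pdivrMr // mul1r ler1n.
apply: ler_wpDr => //.
rewrite D1 mul1r (_ : W = 1) ?mulr1 //.
by rewrite /W eta_eq big1 ?addr0 // => j _; rewrite k0 // mul0r.
Qed.
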